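(* Consider a mirror system of four particles (as defined in the context). A collision between particles 1 and 2 is tachyonic if and only if $0<\sigma_1(\sigma_1-2\mathcal{E})$, where $\sigma_1=E_1+P_1$ is the value for particle 1 immediately before the collision. Moreover, for full solutions (defined for all positive and negative time), with $\Delta=\mathcal{E}^2-\mu$: \begin{itemize} \item if $\Delta<0$, then every solution has infinitely many tachyonic collisions; \item if $\Delta=0$, then every solution has exactly two tachyonic collisions, and they are consecutive; \item if $\Delta>0$, then a solution has tachyonic collisions if and only if $(\sigma_1^0-\mathcal{E})^2>\Delta$, and in this case the number of such collisions is two and they are consecutive. \end{itemize} Here $\sigma_1^0$ is the initial condition of the solution.
   Context: Units are such that the speed of light is $1$. A particle on the real line has energy $E\in\mathbb{R}\setminus\{0\}$, momentum $P\in\mathbb{R}$, velocity $v=P/E$ and squared mass $E^2-P^2$; energies may have either sign. For each particle put $\sigma=E+P$ and $\rho=E-P$. Between collisions particles move with constant velocity. When particles $i,j$ with $v_i\ne v_j$ collide, put $s=\sigma_i+\sigma_j$, $r=\rho_i+\rho_j$; provided $sr\neq0$, the post-collision values are $\sigma_i'=\rho_i s/r$, $\rho_i'=\sigma_i r/s$, $\sigma_j'=\rho_j s/r$, $\rho_j'=\sigma_j r/s$ (total energy, total momentum and each squared mass are preserved). The collision is called tachyonic if $sr=(E_i+E_j)^2-(P_i+P_j)^2<0$. A mirror system consists of four particles with positions $x_1\le x_2\le x_3\le x_4$ such that at all times $x_1=-x_4$, $x_2=-x_3$, $E_1=E_4$, $P_1=-P_4$, $E_2=E_3$, $P_2=-P_3$;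 the squared masses are $\mu_1=\mu_4=\mu>0$ and $\mu_2=\mu_3=0$. Collisions of the pair 1-2 are simultaneous with those of the pair 3-4; particles 2 and 3 collide only at the origin, where they exchange their energies and momenta (so $E_2$ is unchanged and $P_2$ changes sign). Just before a 1-2 collision particle 2 has velocity $-1$. The quantity $\mathcal{E}=E_1+E_2$ is a constant of the motion. Solutions are assumed to be such that every collision, in the future and in the past, can be resolved by the collision rule $\sigma_i'=\rho_i s/r$, $\rho_i'=\sigma_i r/s$, $\sigma_j'=\rho_j s/r$, $\rho_j'=\sigma_j r/s$ ($sr\ne0$), and there are no multiple collisions at the same time and point (in particular $x_1<0$). The collisions between particles 1 and 2 are indexed in time order by $n\in\mathbb{Z}$, and $\sigma_1^n$ denotes the (constant) value of $\sigma_1=E_1+P_1$ between the $n$-th and the $(n+1)$-th such collisions. Tachyonic collisions are counted, and called consecutive, among the collisions of the pair 1-2 (the simultaneous mirror collision 3-4 is not counted separately). *)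

(* Defs.v *)
From HB Require Import structures.
From mathcomp Require Import all_boot all_order all_algebra.
From mathcomp Require Import all_classical all_reals all_analysis.

Set Implicit Arguments.
Unset Strict Implicit.
Unset Printing Implicit Defensive.

Import Order.TTheory GRing.Theory Num.Theory.
Import numFieldNormedType.Exports.

Local Open Scope classical_set_scope.
Local Open Scope ring_scope.

(* Energy and momentum jump at collisions.  Throughout, their values at the
   very instant of a collision are those immediately BEFORE it, i.e. they are
   left-continuous (field [sol_left] below). *)
Record motion (R : realType) (N : nat) := Motion {
  position : 'I_N -> R -> R;
  energy   : 'I_N -> R -> R;
  momentum : 'I_N -> R -> R }.

Section Motion.
Context {R : realType} {N : nat}.
Implicit Types (m : motion R N) (i j k : 'I_N) (t u : R) (D : set R).

Definition velocity m i t : R := momentum m i t / energy m i t.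

Definition squared_mass m i t : R := energy m i t ^+ 2 - momentum m i t ^+ 2.

Definition sigma m i t : R := energy m i t + momentum m i t.

Definition rho m i t : R := energy m i t - momentum m i t.

Definition pair_s m i j t : R := sigma m i t + sigma m j t.

Definition pair_r m i j t : R := rho m i t + rho m j t.

Definition collision m i j t : Prop :=
  [/\ i != j, position m i t = position m j t & velocity m i t != velocity m j t].

Definition resolved m i j t : Prop :=
  let s := pair_s m i j t in
  let r := pair_r m i j t in
  s * r != 0 /\
  \forall u \near t^'+,
    [/\ sigma m i u = rho m i t * s / r, rho m i u = sigma m i t * r / s,
        sigma m j u = rho m j t * s / r & rho m j u = sigma m j t * r / s].

Definition tachyonic m i j t : Prop := pair_s m i j t * pair_r m i j t < 0.

Record is_solution D m : Prop := IsSolution {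
  sol_continuous : forall i t, D t -> {for t, continuous (position m i)};
  sol_energy_neq0 : forall i t, D t -> energy m i t != 0;
  sol_left : forall i t, D t ->
    \forall u \near t^'-, energy m i u = energy m i t /\
                          momentum m i u = momentum m i t;
  sol_free : forall i (a b : R), `]a, b[ `<=` D ->
    (forall t j, a < t < b -> ~ collision m i j t) ->
    forall t u, a < t < b -> a < u < b ->
      [/\ energy m i u = energy m i t, momentum m i u = momentum m i t &
          position m i u = position m i t + velocity m i t * (u - t)];
  sol_collision : forall i j t, D t -> collision m i j t -> resolved m i j t;
  sol_no_multiple : forall i j k t, D t -> i != j -> j != k -> i != k ->
    ~ (position m i t = position m j t /\ position m j t = position m k t) }.

Definition enumerates_collisions m i j (tau : int -> R) : Prop :=
  (forall n k : int, n < k -> tau n < tau k) /\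
  (forall t, collision m i j t <-> exists n, tau n = t).

End Motion.

Definition p1 : 'I_4 := @Ordinal 4 0 isT.
Definition p2 : 'I_4 := @Ordinal 4 1 isT.
Definition p3 : 'I_4 := @Ordinal 4 2 isT.
Definition p4 : 'I_4 := @Ordinal 4 3 isT.

(* [rev_ord] exchanges p1 with p4 and p2 with p3.  By the mirror symmetry 2 and
   3 can only meet at the origin, and there pair_s = pair_r = 2 E_2, so that the
   collision rule is the exchange of their energies and momenta. *)
Record mirror_solution {R : realType} (mu : R) (D : set R) (m : motion R 4)
    : Prop := MirrorSolution {
  mir_interval : is_interval D;
  mir_open : open D;
  mir_solution : is_solution D m;
  mir_order : forall (i j : 'I_4) t, D t -> (i <= j)%N ->
    position m i t <= position m j t;
  mir_position : forall i t, D t -> position m (rev_ord i) t = - position m i t;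
  mir_energy : forall i t, D t -> energy m (rev_ord i) t = energy m i t;
  mir_momentum : forall i t, D t -> momentum m (rev_ord i) t = - momentum m i t;
  mir_mass1 : forall t, D t -> squared_mass m p1 t = mu;
  mir_mass2 : forall t, D t -> squared_mass m p2 t = 0;
  mir_mass3 : forall t, D t -> squared_mass m p3 t = 0;
  mir_mass4 : forall t, D t -> squared_mass m p4 t = mu;
  mir_velocity2 : forall t, D t -> collision m p1 p2 t -> velocity m p2 t = -1 }.

(* Constant in time along a mirror solution. *)
Definition mirror_energy {R : realType} (m : motion R 4) (t : R) : R :=
  energy m p1 t + energy m p2 t.

Definition two_consecutive (T : set int) : Prop :=
  exists n : int, T = [set n; n + 1].

(* Main.v *)
Require Import Defs.
From HB Require Import structures.
From mathcomp Require Import all_boot all_order all_algebra.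
From mathcomp Require Import all_classical all_reals all_analysis.
From mathcomp Require Import ring lra zify.

Set Implicit Arguments.
Unset Strict Implicit.
Unset Printing Implicit Defensive.

Import Order.TTheory GRing.Theory Num.Theory.
Import numFieldNormedType.Exports.

Local Open Scope classical_set_scope.
Local Open Scope ring_scope.

(* Write a_n for the value of sigma_1 just before the n-th 1-2 collision, and c
   for the conserved energy.  There sigma_2 = 0, so s = a_n, r = 2c - a_n, and the
   collision rule becomes a_{n+1} (2c - a_n) = mu, a Moebius recurrence whose fixed
   points are the roots of Q(x) = x^2 - 2cx + mu.  A collision is tachyonic exactly
   when sr < 0, i.e. when a_n and a_{n+1} have opposite signs.
   The sign of Q(a_n) does not depend on n, and a tachyonic collision forces
   Q > 0.  Up to a global change of sign, c >= 0.  An orbit with Q > 0 and no sign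
   change would stay in ]0, 2c[ while moving away from c by steps bounded below (in
   the future or in the past, the two being exchanged by x |-> 2c - x), which is
   absurd; when Delta < 0, Q >= -Delta makes this work from any index on.  When
   Delta >= 0, an orbit that reaches a_n > 2c lies in [c, 2c[ before n and in ]0, c]
   after n + 1, so n and n + 1 are the only sign changes.  Finally
   Q(sigma_1) = -2 sigma_1 E_2 never vanishes, so Q > 0 when Delta = 0. *)

(** * Archimedean growth and integer order *)

Lemma linear_growth_unbounded (R : archiRealFieldType) (u : nat -> R) (e M : R) :
  0 < e -> (forall k, u k + e <= u k.+1) -> ~ (forall k, u k < M).
Proof.
move=> e0 ue uM.
have uk k : u 0%N + e * k%:R <= u k.
  elim: k => [|k ih]; first by rewrite mulr0 addr0.
  by apply: le_trans (ue k); rewrite -natr1; lra.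
pose k := Num.bound `|(M - u 0%N) / e|.
have : (M - u 0%N) / e < k%:R.
  by rewrite (le_lt_trans (ler_norm _)) // archi_boundP.
rewrite ltr_pdivrMr // => Mk.
have := uk k; have := uM k; lra.
Qed.

Lemma int_le_exists_nat (n k : int) : n <= k -> exists j : nat, k = n + j%:Z.
Proof. by move=> nk; exists `|k - n|%N; lia. Qed.

(** * Sign changes along orbits of the Moebius recurrence *)

Section MoebiusOrbit.
Context {R : realType}.
Implicit Types (mu c x : R) (a : int -> R).

(** Free of division: for [mu > 0] the equation itself forces [a n] and [2 * c - a n] to be
    nonzero. *)
Definition moebius_orbit mu c a := forall n, a (n + 1) * (2 * c - a n) = mu.

Definition fixpoly mu c x := x ^+ 2 - 2 * c * x + mu.

Lemma moebius_orbitN mu c a :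
  moebius_orbit mu c a -> moebius_orbit mu (- c) (fun n => - a n).
Proof. by move=> rec n; rewrite -(rec n); ring. Qed.

(* Time reversal: [x |-> 2c - x] conjugates the map to its inverse. *)
Lemma moebius_orbit_rev mu c a :
  moebius_orbit mu c a -> moebius_orbit mu c (fun n => 2 * c - a (- n)).
Proof.
move=> rec n; rewrite -(rec (- (n + 1))).
by rewrite opprD subrK; ring.
Qed.

(** One step multiplies [fixpoly] by [mu / (2 * c - a n) ^+ 2], which is positive for [mu > 0], so
    its sign is an invariant of the orbit. *)
Lemma fixpoly_moebius mu c a n : moebius_orbit mu c a ->
  fixpoly mu c (a (n + 1)) * (2 * c - a n) ^+ 2 = mu * fixpoly mu c (a n).
Proof. by move=> /(_ n) <-; rewrite /fixpoly; ring. Qed.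

Lemma fixpoly_gt0_moebius mu c a n k : 0 < mu -> moebius_orbit mu c a ->
  (0 < fixpoly mu c (a n)) = (0 < fixpoly mu c (a k)).
Proof.
move=> mu0 rec.
have step i : (0 < fixpoly mu c (a (i + 1))) = (0 < fixpoly mu c (a i)).
  rewrite -[RHS](pmulr_rgt0 _ mu0) -fixpoly_moebius // pmulr_lgt0 //.
  rewrite exprn_even_gt0 //=; apply/eqP => z.
  by move: (rec i); rewrite z mulr0 => mu0'; rewrite mu0' ltxx in mu0.
have steps i (j : nat) :
    (0 < fixpoly mu c (a (i + j%:Z))) = (0 < fixpoly mu c (a i)).
  elim: j => [|j ih]; first by rewrite addr0.
  by rewrite -{}ih -[RHS]step; congr (0 < fixpoly _ _ (a _)); lia.
wlog nk : n k / n <= k => [hw|].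
  by have [/hw|/ltW/hw/esym] := leP n k.
by have [j ->] := int_le_exists_nat nk; rewrite steps.
Qed.

(** The exact increment is [fixpoly mu c (a n) / (2 * c - a n)], and the denominator lies in []0, 2
    * c[]. *)
Lemma moebius_step mu c a n : moebius_orbit mu c a ->
  0 < c -> 0 < a n < 2 * c -> 0 <= fixpoly mu c (a n) ->
  a n + fixpoly mu c (a n) / (2 * c) <= a (n + 1).
Proof.
move=> rec c0 /andP[a0 ac] q0.
have d0 : 0 < 2 * c - a n by lra.
have -> : a (n + 1) = a n + fixpoly mu c (a n) / (2 * c - a n).
  rewrite /fixpoly -(rec n); field; lra.
rewrite lerD2l ler_wpM2l // lef_pV2 ?posrE //; lra.
Qed.

Lemma moebius_escape_bounded_below mu c a (N : int) e : 0 < mu ->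
  moebius_orbit mu c a -> 0 < c -> 0 < e ->
  (forall n, N <= n -> e <= fixpoly mu c (a n)) ->
  ~ (forall n, N <= n -> 0 < a n < 2 * c).
Proof.
move=> mu0 rec c0 e0 qe ac.
apply: (@linear_growth_unbounded _ (fun k => a (N + k%:Z)) (e / (2 * c)) (2 * c)).
- by rewrite divr_gt0 // mulr_gt0.
- move=> k.
  have -> : N + k.+1%:Z = N + k%:Z + 1 by lia.
  have Nk : N <= N + k%:Z by lia.
  apply: le_trans (moebius_step rec c0 (ac _ Nk) (le_trans (ltW e0) (qe _ Nk))).
  by rewrite lerD2l ler_pM2r ?qe // invr_gt0 mulr_gt0.
- by move=> k; have /andP[] : 0 < a (N + k%:Z) < 2 * c by apply: ac; lia.
Qed.

(** The orbit is nondecreasing from [N] on, and [fixpoly] increases to the right of [c], so its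
    value at [a N] is a uniform lower bound. *)
Lemma moebius_escape_right mu c a N : 0 < mu -> moebius_orbit mu c a -> 0 < c ->
  c <= a N -> 0 < fixpoly mu c (a N) -> ~ (forall n, 0 < a n < 2 * c).
Proof.
move=> mu0 rec c0 aN qN ac.
have aNk (k : nat) : a N <= a (N + k%:Z).
  elim: k => [|k ih]; first by rewrite addr0.
  have -> : N + k.+1%:Z = N + k%:Z + 1 by lia.
  have qk : 0 < fixpoly mu c (a (N + k%:Z)).
    by rewrite (fixpoly_gt0_moebius _ N mu0 rec).
  apply: le_trans (moebius_step rec c0 (ac _) (ltW qk)).
  by rewrite (le_trans ih) // lerDl divr_ge0 ?(ltW qk) // mulr_ge0 // ltW.
apply: (moebius_escape_bounded_below (N := N) mu0 rec c0 qN).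
  2: by move=> n _; exact: ac.
move=> n Nn.
have [k ->] := int_le_exists_nat Nn; have aNn := aNk k.
by rewrite /fixpoly; nra.
Qed.

Lemma moebius_escape mu c a N : 0 < mu -> moebius_orbit mu c a -> 0 < c ->
  0 < fixpoly mu c (a N) -> ~ (forall n, 0 < a n < 2 * c).
Proof.
move=> mu0 rec c0 qN ac.
have [ca|ac'] := leP c (a N); first exact: (moebius_escape_right mu0 rec c0 ca qN).
(* Left of [c], reverse time: the reversed orbit takes at [- N] the value [2 * c - a N], which is
   right of [c], and [fixpoly] is symmetric about [c]. *)
apply: (@moebius_escape_right mu c _ (- N) mu0 (moebius_orbit_rev rec) c0).
- by rewrite opprK; lra.
- by rewrite opprK; move: qN; rewrite /fixpoly; nra.
- by move=> n; have := ac (- n); lra.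
Qed.

Lemma moebius_orbit_neq0 mu c a n : 0 < mu -> moebius_orbit mu c a ->
  a n != 0 /\ a n - 2 * c != 0.
Proof.
move=> mu0 rec; split; apply/eqP => z.
  by have := rec (n - 1); rewrite subrK z; lra.
have z' : 2 * c - a n = 0 by lra.
by have := rec n; rewrite z'; lra.
Qed.

Lemma moebius_no_sign_change mu c a n : 0 < mu -> moebius_orbit mu c a -> 0 < c ->
  ~ 0 < a n * (a n - 2 * c) -> 0 < a n < 2 * c.
Proof.
move=> mu0 rec c0 /negP; rewrite -leNgt le_eqVlt.
have [/negbTE a0 /negbTE ac] := moebius_orbit_neq0 n mu0 rec.
rewrite mulf_eq0 a0 ac /= => h.
by apply/andP; split; rewrite ltNge; apply/negP => ?; nra.
Qed.

Lemma moebius_sign_change mu c a N : 0 < mu -> moebius_orbit mu c a ->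
  0 < fixpoly mu c (a N) -> exists n, 0 < a n * (a n - 2 * c).
Proof.
move=> mu0; wlog c0 : c a / 0 <= c => [hw|].
  case: (leP 0 c) => [|/ltW] c0; first exact: hw.
  move=> rec qN.
  have c0' : 0 <= - c by lra.
  have qN' : 0 < fixpoly mu (- c) (- a N) by move: qN; rewrite /fixpoly; lra.
  by have [n an] := hw _ _ c0' (moebius_orbitN rec) qN'; exists n; lra.
move=> rec qN; apply: contrapT => /forallNP noT.
(* For [c = 0] the sign-change condition is [0 < a n ^+ 2], true at every index. *)
have [cz|cn0] := eqVneq c 0.
  have [a0 _] := moebius_orbit_neq0 N mu0 rec.
  by apply: (noT N); rewrite cz mulr0 subr0 -expr2 exprn_even_gt0 //=.
have {cn0}c0 : 0 < c by rewrite lt_neqAle eq_sym cn0.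
apply: (moebius_escape mu0 rec c0 qN) => n.
exact: (moebius_no_sign_change mu0 rec c0 (noT n)).
Qed.

(** Here [fixpoly] is at least [mu - c ^+ 2 > 0] on the whole line, so the escape argument can start
    at any index. *)
Lemma moebius_elliptic mu c a N : 0 < mu -> moebius_orbit mu c a ->
  c ^+ 2 < mu -> exists2 n, N <= n & 0 < a n * (a n - 2 * c).
Proof.
move=> mu0; wlog c0 : c a / 0 <= c => [hw|].
  case: (leP 0 c) => [|/ltW] c0; first exact: hw.
  move=> rec cmu.
  have c0' : 0 <= - c by lra.
  rewrite -sqrrN in cmu.
  by have [n Nn an] := hw _ _ c0' (moebius_orbitN rec) cmu; exists n => //; lra.
move=> rec cmu; apply: contrapT => noT'.
have noT n : N <= n -> ~ 0 < a n * (a n - 2 * c) by move=> Nn ?; apply: noT'; exists n.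
have [cz|cn0] := eqVneq c 0.
  have [a0 _] := moebius_orbit_neq0 N mu0 rec.
  by apply: (noT N) => //; rewrite cz mulr0 subr0 -expr2 exprn_even_gt0 //=.
have {cn0}c0 : 0 < c by rewrite lt_neqAle eq_sym cn0.
apply: (@moebius_escape_bounded_below mu c a N (mu - c ^+ 2)) => //.
- lra.
- by move=> n _; rewrite /fixpoly; have := sqr_ge0 (a n - c); lra.
- by move=> n Nn; apply: (moebius_no_sign_change mu0 rec c0 (noT n Nn)).
Qed.

Lemma sign_change_fixpoly mu c x : 0 < mu -> 0 < x * (x - 2 * c) ->
  0 < fixpoly mu c x.
Proof. by rewrite /fixpoly; lra. Qed.

(** The interval []0, c]] is forward invariant: [y <= c] gives [mu / (2 * c - y) <= mu / c <= c]. *)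
Lemma moebius_after mu c a n k : 0 < mu -> moebius_orbit mu c a -> 0 < c ->
  mu <= c ^+ 2 -> 0 < a n <= c -> n <= k -> 0 < a k <= c.
Proof.
move=> mu0 rec c0 cmu an nk.
have [j ->] := int_le_exists_nat nk; elim: j {nk} => [|j]; first by rewrite addr0.
have -> : n + j.+1%:Z = n + j%:Z + 1 by lia.
have := rec (n + j%:Z); move: (a _) (a _) => y x xy /andP[y0 yc].
have d0 : 0 < 2 * c - y by lra.
have x0 : 0 < x by rewrite -(pmulr_lgt0 _ d0) xy.
by rewrite x0 /= leNgt; apply/negP => ?; nra.
Qed.

(** This is [moebius_after] for the reversed orbit, started at [2 * c - a (n - 1) = mu / a n], which
    lies in []0, c]]. *)
Lemma moebius_before mu c a n k : 0 < mu -> moebius_orbit mu c a -> 0 < c ->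
  mu <= c ^+ 2 -> 2 * c < a n -> k < n -> c <= a k < 2 * c.
Proof.
move=> mu0 rec c0 cmu an kn.
have := @moebius_after mu c _ (- (n - 1)) (- k) mu0 (moebius_orbit_rev rec) c0 cmu.
rewrite /= !opprK => h.
have := rec (n - 1); rewrite subrK => rn.
have : 0 < 2 * c - a k <= c; last lra.
apply: h; last by lia.
have d0 : 0 < 2 * c - a (n - 1) by rewrite -(pmulr_rgt0 _ (_ : 0 < a n)) ?rn //; lra.
by rewrite d0 /= leNgt; apply/negP => ?; nra.
Qed.

Lemma moebius_two_consecutive mu c a N : 0 < mu -> moebius_orbit mu c a ->
  mu <= c ^+ 2 -> 0 < a N * (a N - 2 * c) ->
  two_consecutive [set n | 0 < a n * (a n - 2 * c)].
Proof.
move=> mu0; wlog c0 : c a / 0 <= c => [hw|].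
  case: (leP 0 c) => [|/ltW] c0; first exact: hw.
  move=> rec cmu aN.
  have c0' : 0 <= - c by lra.
  have aN' : 0 < - a N * (- a N - 2 * - c) by lra.
  rewrite -sqrrN in cmu.
  have [n Tn] := hw _ _ c0' (moebius_orbitN rec) cmu aN'.
  exists n; rewrite -Tn; apply/funext => k /=.
  by congr (is_true (0 < _)); ring.
move=> rec cmu aN.
have {}c0 : 0 < c.
  by rewrite lt_neqAle c0 andbT; apply/eqP => c0'; move: cmu; rewrite -c0' expr0n /=; lra.
(* The sign condition at [N] means [a N < 0] or [a N > 2 * c]; in the first case the recurrence puts
   the predecessor above [2 * c]. *)
have [n an] : exists n, 2 * c < a n.
  have [aN0|aN0] := ltP (a N) 0; last by exists N; nra.
  exists (N - 1); have := rec (N - 1); rewrite subrK => ?.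
  by rewrite ltNge; apply/negP => ?; nra.
have an1 : a (n + 1) < 0 by have := rec n; rewrite ltNge => ?; apply/negP => ?; nra.
(* Since [a (n + 1) < 0], the next value is below [mu / (2 * c)], hence below [c]. *)
have an2 : 0 < a (n + 1 + 1) <= c.
  have h := rec (n + 1).
  have d0 : 2 * c < 2 * c - a (n + 1) by lra.
  have x0 : 0 < a (n + 1 + 1) by rewrite -(pmulr_lgt0 _ (_ : 0 < 2 * c - a (n + 1))) ?h //; lra.
  by rewrite x0 /= leNgt; apply/negP => ?; nra.
exists n; apply/seteqP; split=> k /=; last first.
  by case=> ->; [rewrite pmulr_rgt0; lra | rewrite nmulr_rgt0; lra].
move=> ak; have [kn|kn|->] := ltgtP k n; last by left.
  exfalso; have /andP[? ?] := moebius_before mu0 rec c0 cmu an kn.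
  by move: ak; rewrite pmulr_rgt0; lra.
have [->|k1] := eqVneq k (n + 1); first by right.
have nk : n + 1 + 1 <= k by lia.
exfalso; have /andP[? ?] := moebius_after mu0 rec c0 cmu an2 nk.
by move: ak; rewrite pmulr_rgt0; lra.
Qed.

End MoebiusOrbit.

(** * Infinite sets of integers and locally constant functions *)

Lemma unbounded_int_infinite (T : set int) :
  (forall N, exists2 n, N <= n & T n) -> infinite_set T.
Proof.
move=> unbT /finite_seqP[s Ts].
have [M sM] : exists M : int, forall n, n \in s -> n < M.
  elim: s {Ts} => [|x s [M ih]]; first by exists 0.
  exists (Num.max M (x + 1)) => n; rewrite inE lt_max => /predU1P[->|/ih ->//].
  by apply/orP; right; lia.
have [n Mn] := unbT M.
by rewrite Ts => /sM; rewrite ltNge Mn.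
Qed.

Lemma near_left_right (R : realType) (t : R) (P : set R) : P t ->
  (\forall u \near t^'-, P u) -> (\forall u \near t^'+, P u) ->
  \forall u \near t, P u.
Proof.
move=> Pt [e /= e0 Pl] [d /= d0 Pr].
exists (Num.min e d) => /=; first by rewrite lt_min e0.
move=> u /=; rewrite lt_min => /andP[ue ud].
by have [tu|ut|<-] := ltgtP t u; [apply: Pr|apply: Pl|].
Qed.

(** By connectedness: the level set of [f] through [t] is relatively open and closed in [D]. *)
Lemma locally_constant_interval (R : realType) (S : Type) (D : set R) (f : R -> S) :
  is_interval D -> (forall t, D t -> \forall u \near t, f u = f t) ->
  forall t u, D t -> D u -> f t = f u.
Proof.
move=> /connected_intervalP Dconn floc t u Dt Du.
pose E := [set v | f v = f t].
suff : D `&` E = D by move=> /seteqP[_ /(_ u Du)[_ ->]].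
apply: Dconn; first by exists t.
- exists E°; first exact: open_interior.
  apply/seteqP; split=> v [Dv Ev]; split=> //; last exact: interior_subset.
  by have := floc v Dv; apply: filterS => w; rewrite /E /= => ->.
- exists (~` (~` E)°); first by apply: open_closedC; exact: open_interior.
  apply/seteqP; split=> v [Dv Ev]; split=> //.
    by move=> /interior_subset.
  apply: contrapT => nEv; apply: Ev.
  by have := floc v Dv; apply: filterS => w; rewrite /E /= => ->.
Qed.

(** * Dynamics of a mirror solution and conservation of its energy *)

Section MirrorSolution.
Context {R : realType} (mu : R) (D : set R) (m : motion R 4).
Hypotheses (mu_gt0 : 0 < mu) (sol : mirror_solution mu D m).
Implicit Types (t u : R) (i j : 'I_4).

Let msol := mir_solution sol.

Lemma energyE i t : energy m i t = (sigma m i t + rho m i t) / 2.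
Proof. by rewrite /sigma /rho; field. Qed.

Lemma sigma_rho1 t : D t -> sigma m p1 t * rho m p1 t = mu.
Proof.
by move=> Dt; rewrite -(mir_mass1 sol Dt) /sigma /rho /squared_mass; ring.
Qed.

Lemma rev_p2 : rev_ord p2 = p3. Proof. exact: val_inj. Qed.

Lemma velocity3 t : D t -> velocity m p3 t = - velocity m p2 t.
Proof.
move=> Dt; rewrite /velocity -rev_p2 (mir_momentum sol) // (mir_energy sol) //.
by rewrite mulNr.
Qed.

Lemma velocity2_sqr t : D t -> velocity m p2 t ^+ 2 = 1.
Proof.
move=> Dt; have E2 := sol_energy_neq0 msol p2 Dt.
have := mir_mass2 sol Dt; rewrite /squared_mass /velocity => /subr0_eq h.
by rewrite expr_div_n -h divff // expf_neq0.
Qed.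

(** Contact suffices: equal velocities would give particle 1 unit speed, hence squared mass zero. *)
Lemma collision12 t : D t -> position m p1 t = position m p2 t ->
  collision m p1 p2 t.
Proof.
move=> Dt x12; split=> //; apply/eqP => v12.
have := velocity2_sqr Dt; rewrite -v12 /velocity expr_div_n => h.
have := mir_mass1 sol Dt; have E1 := sol_energy_neq0 msol p1 Dt.
have E1' : energy m p1 t ^+ 2 != 0 by rewrite expf_neq0.
rewrite /squared_mass -[momentum _ _ _ ^+ 2](divfK E1') h mul1r subrr => mu0.
by move: mu_gt0; rewrite -mu0 ltxx.
Qed.

Lemma collision23 t : D t -> position m p2 t = position m p3 t ->
  collision m p2 p3 t.
Proof.
move=> Dt x23; split=> //; rewrite velocity3 //; apply/eqP => v23.
have v0 : velocity m p2 t = 0 by lra.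
by have := velocity2_sqr Dt; rewrite v0 expr0n /=; lra.
Qed.

(** Were particle 1 to meet 3 or 4, the ordering would squeeze particle 2 into the same point, a
    multiple collision. *)
Lemma collision1 t j : D t -> collision m p1 j t -> j = p2.
Proof.
move=> Dt [j1 x1j _]; apply/eqP; apply: contrapT => /negP j2.
have lt1j : (p2 <= j)%N by move: j1; rewrite -val_eqE /=; case: (val j).
apply: (sol_no_multiple msol (i := p1) (j := p2) (k := j) Dt) => //.
  by rewrite eq_sym.
have := mir_order sol Dt (i := p1) (j := p2) isT.
have := mir_order sol Dt lt1j; rewrite -x1j => ? ?.
by have -> : position m p2 t = position m p1 t by apply/eqP; rewrite eq_le; apply/andP.
Qed.

Lemma domain_near t : D t -> \forall u \near t, D u.
Proof. by move=> Dt; apply: open_nbhs_nbhs; split=> //; exact: mir_open sol. Qed.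

Lemma energy_near_free i t : D t ->
  (\forall u \near t, forall j, ~ collision m i j u) ->
  \forall u \near t, energy m i u = energy m i t.
Proof.
move=> Dt nocoll.
have [e /= e0 he] := filterI (domain_near Dt) nocoll.
have be u : t - e < u < t + e -> `|t - u| < e.
  by move=> /andP[? ?]; rewrite ltr_norml; lra.
exists e => //= u ue.
have {}ue : - e < t - u < e by rewrite -ltr_norml.
have [] // := sol_free msol (i := i) (a := t - e) (b := t + e) _ _ (t := t) (u := u).
- by move=> v /=; rewrite in_itv /= => /be/he[].
- by move=> v j /be/he[_]; exact.
- by lra.
- by lra.
Qed.

Lemma position_lt_near i j t : D t -> position m i t < position m j t ->
  \forall u \near t, position m i u < position m j u.
Proof.
move=> Dt xij.
have ci := sol_continuous msol (i := i) Dt; have cj := sol_continuous msol (i := j) Dt.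
have := cvgr_gt _ (cvgB cj ci) 0; rewrite subr_gt0 => /(_ _ _ xij).
by apply: filterS => u; rewrite /= subr_gt0.
Qed.

Lemma resolved_energy2 t : D t -> resolved m p2 p3 t ->
  \forall u \near t^'+, energy m p2 u = energy m p2 t.
Proof.
move=> Dt [_]; apply: filterS => u [s2 r2 _ _].
have E2 := sol_energy_neq0 msol p2 Dt.
rewrite [LHS]energyE s2 r2 /pair_s /pair_r /sigma /rho -rev_p2.
rewrite (mir_momentum sol) // (mir_energy sol) //.
by field; rewrite addrACA subrr addr0 -mulr2n mulrn_eq0.
Qed.

(** The rule swaps the totals: the new sigmas add up to [s] and the new rhos to [r], so the energy
    stays [(s + r) / 2]. *)
Lemma resolved_mirror_energy t : resolved m p1 p2 t ->
  \forall u \near t^'+, mirror_energy m u = mirror_energy m t.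
Proof.
move=> [sr0]; apply: filterS => u [s1 r1 s2 r2].
rewrite mulf_eq0 negb_or in sr0; case/andP: sr0 => s0 r0.
rewrite /mirror_energy !energyE s1 r1 s2 r2.
move: s0 r0; rewrite /pair_s /pair_r => s0 r0.
by field; rewrite r0 s0.
Qed.

Lemma no_collision2 t j : D t ->
  position m p1 t < position m p2 t -> position m p2 t < position m p3 t ->
  ~ collision m p2 j t.
Proof.
move=> Dt x12 x23 [j2 x2j _].
have [lt3j|] := leqP p3 j.
  by have := mir_order sol Dt lt3j; rewrite -x2j leNgt x23.
move: j2; rewrite -val_eqE /= ltnS leq_eqVlt => /negbTE j2.
rewrite eq_sym j2 /= ltnS leqn0 => /eqP j1.
have j1' : j = p1 by exact: val_inj.
by move: x12; rewrite x2j j1' ltxx.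
Qed.

(** Only when 1 meets 2 is the sum itself needed; otherwise both energies are separately constant
    near [t], a 2-3 collision preserving that of particle 2. *)
Lemma mirror_energy_near t : D t ->
  \forall u \near t, mirror_energy m u = mirror_energy m t.
Proof.
move=> Dt.
have [x12|x12'] := eqVneq (position m p1 t) (position m p2 t).
  apply: near_left_right => //.
    apply: filterS2 (sol_left msol p1 Dt) (sol_left msol p2 Dt).
    by move=> u [E1 _] [E2 _]; rewrite /mirror_energy E1 E2.
  apply: resolved_mirror_energy.
  exact: (sol_collision msol Dt (collision12 Dt x12)).
have x12 : position m p1 t < position m p2 t.
  by rewrite lt_neqAle x12' (mir_order sol Dt).
have near12 := position_lt_near Dt x12.
have E1 : \forall u \near t, energy m p1 u = energy m p1 t.
  apply: energy_near_free => //.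
  apply: filterS2 (domain_near Dt) near12 => u Du x12u j c.
  by move: (c); rewrite (collision1 Du c) => -[_ e _]; rewrite e ltxx in x12u.
suff E2 : \forall u \near t, energy m p2 u = energy m p2 t.
  by apply: filterS2 E1 E2 => u E1u E2u; rewrite /mirror_energy E1u E2u.
have [x23|x23'] := eqVneq (position m p2 t) (position m p3 t).
  apply: near_left_right => //.
    by have := sol_left msol p2 Dt; apply: filterS => u [].
  apply: resolved_energy2 => //.
  exact: (sol_collision msol Dt (collision23 Dt x23)).
have x23 : position m p2 t < position m p3 t.
  by rewrite lt_neqAle x23' (mir_order sol Dt).
apply: energy_near_free => //.
apply: filterS3 (domain_near Dt) near12 (position_lt_near Dt x23).
by move=> u Du x12u x23u j; exact: no_collision2.
Qed.

Lemma mirror_energy_cst t u : D t -> D u -> mirror_energy m t = mirror_energy m u.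
Proof. exact: (locally_constant_interval (mir_interval sol) mirror_energy_near). Qed.

Lemma collision12_sr t : D t -> collision m p1 p2 t ->
  pair_s m p1 p2 t = sigma m p1 t /\
  pair_r m p1 p2 t = 2 * mirror_energy m t - sigma m p1 t.
Proof.
move=> Dt c; have E2 := sol_energy_neq0 msol p2 Dt.
have P2 : momentum m p2 t = - energy m p2 t.
  have := mir_velocity2 sol Dt c; rewrite /velocity => h.
  by rewrite -[LHS](divfK E2) h mulN1r.
by rewrite /pair_s /pair_r /mirror_energy /sigma /rho P2; split; ring.
Qed.

Lemma tachyonic12E t : D t -> collision m p1 p2 t ->
  tachyonic m p1 p2 t <->
  0 < sigma m p1 t * (sigma m p1 t - 2 * mirror_energy m t).
Proof.
move=> Dt c; rewrite /tachyonic; have [-> ->] := collision12_sr Dt c.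
by split; lra.
Qed.

(** With [s = sigma_1], the rule gives [sigma_1' * r = rho_1 * sigma_1], which is the squared
    mass. *)
Lemma sigma1_after t : D t -> collision m p1 p2 t ->
  \forall u \near t^'+,
    sigma m p1 u * (2 * mirror_energy m t - sigma m p1 t) = mu.
Proof.
move=> Dt c; have [sr0] := sol_collision msol Dt c.
have [sE rE] := collision12_sr Dt c.
rewrite mulf_eq0 negb_or in sr0; case/andP: sr0 => s0 r0.
apply: filterS => u [-> _ _ _]; rewrite -rE divfK // sE mulrC.
exact: sigma_rho1.
Qed.

Lemma sigma1_between (a b u : R) : (forall v, a < v <= b -> D v) ->
  (forall v, a < v < b -> ~ collision m p1 p2 v) ->
  a < u < b -> sigma m p1 u = sigma m p1 b.
Proof.
move=> abD nocoll aub.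
have ab : a < b by lra.
have Db : D b by apply: abD; rewrite ab lexx.
(* Free motion covers only the open interval; a point [v] just left of [b] links it to the
   left-continuous value at [b]. *)
have nearb : \forall v \near b^'-,
    [/\ energy m p1 v = energy m p1 b /\ momentum m p1 v = momentum m p1 b,
        a < v & v < b].
  by apply: filterS3 (sol_left msol p1 Db) (nbhs_left_gt ab) (nbhs_left_lt b).
case: (@filter_ex _ _ (at_left_proper_filter b) _ nearb) => v [[Ev Pv] av vb].
have [] // := sol_free msol (i := p1) (a := a) (b := b) _ _ (t := v) (u := u).
- by move=> w /=; rewrite in_itv /= => /andP[aw /ltW wb]; apply: abD; rewrite aw.
- move=> w j awb c; apply: (nocoll w awb); rewrite -(collision1 _ c) //.
  by apply: abD; lra.
- by rewrite av.
by move=> Eu Pu _; rewrite /sigma Eu Pu Ev Pv.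
Qed.

Lemma fixpoly_sigma1 t : D t ->
  fixpoly mu (mirror_energy m t) (sigma m p1 t) = - 2 * sigma m p1 t * energy m p2 t.
Proof.
move=> Dt; rewrite /fixpoly -(mir_mass1 sol Dt).
by rewrite /mirror_energy /sigma /squared_mass; ring.
Qed.

End MirrorSolution.

(** * Full solutions as Moebius orbits *)

Section FullMirrorSolution.
Context {R : realType} (mu : R) (m : motion R 4).
Hypotheses (mu_gt0 : 0 < mu) (sol : mirror_solution mu setT m).
Context (tau : int -> R) (enum_tau : enumerates_collisions m p1 p2 tau).

Lemma collision_tau n : collision m p1 p2 (tau n).
Proof. by apply/(enum_tau.2 (tau n)); exists n. Qed.

Lemma sigma1_tau n u : tau n < u < tau (n + 1) ->
  sigma m p1 u = sigma m p1 (tau (n + 1)).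
Proof.
apply: (sigma1_between sol) => // v /[swap] /(enum_tau.2 v)[k <-].
have tau_mono : {mono tau : i j / i < j}.
  by apply: leW_mono; apply: le_mono => i j; apply: enum_tau.1.
by rewrite !tau_mono; lia.
Qed.

Lemma sigma1_orbit t :
  moebius_orbit mu (mirror_energy m t) (fun n => sigma m p1 (tau n)).
Proof.
move=> n; have tn : tau n < tau (n + 1) by apply: enum_tau.1; lia.
(* A time [u] just after [tau n] sees the outcome of that collision and already carries the value of
   [sigma] at [tau (n + 1)]. *)
have neartau : \forall u \near (tau n)^'+,
    [/\ sigma m p1 u * (2 * mirror_energy m (tau n) - sigma m p1 (tau n)) = mu,
        tau n < u & u < tau (n + 1)].
  have after_n := sigma1_after sol (t := tau n) Logic.I (collision_tau n).
  by apply: filterS3 after_n (nbhs_right_gt (tau n)) (nbhs_right_lt tn).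
case: (@filter_ex _ _ (at_right_proper_filter (tau n)) _ neartau) => u [su nu un].
rewrite -(@sigma1_tau n u); last by rewrite nu.
by rewrite (mirror_energy_cst mu_gt0 sol (t := t) (u := tau n)).
Qed.

End FullMirrorSolution.

Theorem theorem18 (R : realType) (mu : R) (mu_gt0 : 0 < mu) (D : set R)
    (m : motion R 4) (sol : mirror_solution mu D m) (t0 : R) (Dt0 : D t0) :
  let cE := mirror_energy m t0 in
  let Delta := cE ^+ 2 - mu in
  (forall t : R, D t -> collision m p1 p2 t ->
     (tachyonic m p1 p2 t <-> 0 < sigma m p1 t * (sigma m p1 t - 2 * cE)))
  /\
  (D = setT ->
   forall tau : int -> R, enumerates_collisions m p1 p2 tau ->
   let T := [set n : int | tachyonic m p1 p2 (tau n)] in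
   [/\ Delta < 0 -> infinite_set T,
       Delta = 0 -> two_consecutive T &
       0 < Delta ->
         (forall t : R, tau 0 < t < tau 1 ->
            (T !=set0 <-> Delta < (sigma m p1 t - cE) ^+ 2)) /\
         (T !=set0 -> two_consecutive T)]).
Proof.
move=> cE Delta.
have tachE t : D t -> collision m p1 p2 t ->
    (tachyonic m p1 p2 t <-> 0 < sigma m p1 t * (sigma m p1 t - 2 * cE)).
  by move=> Dt c; rewrite /cE (mirror_energy_cst mu_gt0 sol Dt0 Dt); exact: (tachyonic12E sol).
split=> // DT tau enum_tau; subst D.
pose a n := sigma m p1 (tau n).
have rec : moebius_orbit mu cE a := sigma1_orbit mu_gt0 sol enum_tau t0.
have -> : [set n | tachyonic m p1 p2 (tau n)] = [set n | 0 < a n * (a n - 2 * cE)].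
  apply/funext => n; apply/propext.
  exact: tachE (collision_tau enum_tau n).
move=> T.
have T2 : 0 <= Delta -> T !=set0 -> two_consecutive T.
  move=> D0 [n Tn]; apply: (moebius_two_consecutive mu_gt0 rec _ Tn).
  by rewrite -subr_ge0.
(* The index is 1 because the value of [sigma] between [tau 0] and [tau 1] is, by left continuity,
   [a 1]. *)
have Tgt0 : 0 < fixpoly mu cE (a 1) <-> T !=set0.
  split=> [q1|[n Tn]]; first by have [n Tn] := moebius_sign_change mu_gt0 rec q1; exists n.
  by rewrite (fixpoly_gt0_moebius 1 n mu_gt0 rec) sign_change_fixpoly.
have fixpolyE : fixpoly mu cE (a 1) = (a 1 - cE) ^+ 2 - Delta.
  by rewrite /fixpoly /Delta; ring.
split=> [D0|D0|D0].
- apply: unbounded_int_infinite => N.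
  by apply: (moebius_elliptic N mu_gt0 rec); rewrite -subr_lt0.
- apply: T2; first by rewrite D0.
  apply/Tgt0; rewrite fixpolyE D0 subr0 exprn_even_gt0 //=.
  (* This excludes the double root [a 1 = cE], where the orbit would be stationary. *)
  have : fixpoly mu cE (a 1) != 0.
    rewrite /cE (mirror_energy_cst mu_gt0 sol (t := t0) (u := tau 1)) //.
    rewrite (fixpoly_sigma1 sol) // !mulf_neq0 ?oppr_eq0 ?pnatr_eq0 //.
      by have [] := moebius_orbit_neq0 1 mu_gt0 rec.
    exact: (sol_energy_neq0 (mir_solution sol)).
  by rewrite fixpolyE D0 subr0 sqrf_eq0.
- split; last exact: T2 (ltW D0).
  move=> t tt; rewrite (sigma1_tau mu_gt0 sol enum_tau (n := 0) tt) add0r.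
  by rewrite -subr_gt0 -fixpolyE; split=> /Tgt0.
Qed.
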